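(* For every fixed symmetric distribution function $g$, the class of $g$-weighted integral means of the second kind is minimal and complete. That is: (minimality) if $M_1,M_2$ are $g$-weighted integral means of the second kind with $Q_{M_1}=Q_{M_2}$, then $M_1=M_2$; (completeness) for every infinitely differentiable function $u:(0,+\infty)\to\mathbb{R}$ there exists a $g$-weighted integral mean of the second kind $M$ with $Q_M=u$.
   Context: A mean is a function $M:(0,+\infty)^2\to(0,+\infty)$ of class $C^\infty$ such that $\min(x,y)\le M(x,y)\le\max(x,y)$ and $M(x,y)=M(y,x)$ for all $x,y>0$. The characteristic function of a mean $M$ is $Q_M:(0,+\infty)\to\mathbb{R}$, $Q_M(x):=\frac{\partial^2 M}{\partial x^2}(x,x)$ (second partial derivative with respect to the first variable, evaluated at $(x,x)$). A function $g:[0,1]\to\mathbb{R}$ is a symmetric distribution function if: (i) $g\ge0$ almost everywhere on $[0,1]$; (ii) $g$ is Lebesgue-integrable on $[0,1]$ with $\int_0^1 g(t)\,dt=1$; (iii) $g(t)=g(1-t)$ for almost all $t\in[0,1]$. A $g$-weighted integral mean of the second kind is a mean of the form $M(x,y)=\int_0^1 f\left(t f^{-1}(x)+(1-t)f^{-1}(y)\right)g(t)\,dt$ for all $x,y>0$, where $f$ is a strictly monotonic and infinitely differentiable function on some interval $I\subseteq\mathbb{R}$ with $f(I)=(0,+\infty)$ (the interval $I$ and the function $f$ may depend on $M$). *)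

(* Defs.v *)
From HB Require Import structures.
From mathcomp Require Import all_boot all_order all_algebra.
From mathcomp Require Import all_classical all_reals all_analysis.
Set Implicit Arguments.
Unset Strict Implicit.
Unset Printing Implicit Defensive.
Import Order.TTheory GRing.Theory Num.Theory.
Import numFieldNormedType.Exports.
Local Open Scope classical_set_scope.
Local Open Scope ring_scope.

(* Functions on a subset of R or of R * R are total functions whose values
   outside the subset are never used. *)

Definition posR (R : realType) : set R := [set x | 0 < x].

Definition quadrant (R : realType) : set (R * R) :=
  [set p | 0 < p.1 /\ 0 < p.2].

(* The derivatives are two-sided, which is the usual notion only for open A:
   here A is either posR or an interval mapped by a strictly monotonic function
   onto posR, and such an interval is open since posR has neither a least nor a
   greatest element. *)
Definition smooth_on (R : realType) (A : set R) (f : R -> R) : Prop :=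
  forall (n : nat) (x : R), A x -> derivable (f^`(n)%classic) x 1.

Definition axis (R : realType) (i : bool) : R * R :=
  if i then (0, 1) else (1, 0).

Definition iterated_partial (R : realType) (s : seq bool) (F : R * R -> R) :
    R * R -> R :=
  foldr (fun i G => 'D_(axis R i) G) F s.

Definition smooth2_on (R : realType) (A : set (R * R)) (F : R * R -> R) : Prop :=
  forall (s : seq bool) (p : R * R), A p ->
    {for p, continuous (iterated_partial s F)} /\
    forall i : bool, derivable (iterated_partial s F) p (axis R i).

Definition is_mean (R : realType) (M : R * R -> R) : Prop :=
  [/\ smooth2_on (@quadrant R) M,
      forall x y : R, 0 < x -> 0 < y ->
        Num.min x y <= M (x, y) <= Num.max x y &
      forall x y : R, 0 < x -> 0 < y -> M (x, y) = M (y, x)].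

Definition charac (R : realType) (M : R * R -> R) (x : R) : R :=
  'D_(axis R false) ('D_(axis R false) M) (x, x).

(* [lebesgue_measure] lives on the Borel sets; its completion lives on all
   Lebesgue-measurable sets, so that g need not be Borel measurable. *)
Definition sym_distr (R : realType) (g : R -> R) : Prop :=
  let mu := @completed_lebesgue_measure R in
  [/\ {ae mu, forall t, `[0, 1]%classic t -> 0 <= g t},
      mu.-integrable `[0, 1] (EFin \o g),
      \int[mu]_(t in `[0, 1]) g t = 1 &
      {ae mu, forall t, `[0, 1]%classic t -> g t = g (1 - t)}].

Definition integral_mean2 (R : realType) (g : R -> R) (M : R * R -> R) : Prop :=
  is_mean M /\
  exists (I : set R) (f : R -> R),
    [/\ is_interval I, smooth_on I f, unstable.strict_monotonic I f, f @` I = @posR R &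
        let finv := 'pinv_(fun=> 0) I f in
        forall x y : R, 0 < x -> 0 < y ->
          M (x, y) = \int[@completed_lebesgue_measure R]_(t in `[0, 1])
                       (f (t * finv x + (1 - t) * finv y) * g t)].

(* Main.v *)
Require Import Defs.
From mathcomp Require Import all_boot all_order all_algebra.
From mathcomp Require Import all_classical all_reals all_analysis.
From mathcomp Require Import measurable_realfun.
From mathcomp Require Import ring lra.
Set Implicit Arguments.
Unset Strict Implicit.
Unset Printing Implicit Defensive.
Import Order.TTheory GRing.Theory Num.Theory.
Import numFieldNormedType.Exports.
Local Open Scope classical_set_scope.
Local Open Scope ring_scope.

(** Write [L h] for the integral of [h t * g t] over the unit interval
    ([wint g h]).  Since [g] is a symmetric probability density, [L] is a
    positive linear functional on continuous functions, [L 1 = 1], and [L] is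
    invariant under [t |-> 1 - t]; hence [L t = 1/2], and [L (t^2) < 1/2]
    because [t - t^2] is positive inside the interval and [g] is not null.

    Let [M] have generator [f] on the interval [I] and let [p] be the inverse
    of [f], so that [M (x, y) = G (p x, p y)] with
    [G (s, r) = L (f (t s + (1 - t) r))].  Differentiating [G] twice in [s]
    under the integral sign and putting [s = r] gives the formula on which both
    halves rest ([charac_generator]):
      [Q_M x = (L (t^2) - 1/2) * f'' (p x) / f' (p x) ^ 2].

    The formula needs [f'] without zeros, which strict monotonicity does not
    give (think of a cube).  It comes from the smoothness of [M]
    ([generator_derive_neq0]).  If [f' s = 0], then by the chain rule
    [r |-> dG/ds (s, r) = L (t f' (t s + (1 - t) r))] vanishes identically.
    As [f'] has a constant sign, the integrand vanishes almost everywhere, and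
    then so does the integrand of [dG/dr (s, r)].  Thus [G (s, r)] does not
    depend on [r], so [L (f (t s + (1 - t) r) - f s) = 0] for every [r], against
    strict monotonicity.

    Minimality ([integral_mean2_minimal]).  The slope [a x = f' (p x)] satisfies
    [a' = q a] with [q = f'' (p x) / f' (p x) ^ 2], and [q] is determined by
    [Q_M].  So two generators with the same [Q_M] have proportional slopes;
    since [p' = 1 / a], their inverses differ by an affine map of the line,
    and affine maps commute with the convex combinations defining [M].

    Completeness ([integral_mean2_complete]).  Given [u], solve the equation
    backwards: [W' = u / (L (t^2) - 1/2)], [p' = exp (- W)], [f] the inverse of
    [p].  Then [f' = exp (W o f)], which yields [q = W'] and the smoothness of
    [f].  The mean is smooth because all its iterated partial derivatives stay
    in one span ([segint_span]) of products of one-variable smooth functions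
    with integrals [L (w t * f^(n) (t p x + (1 - t) p y))]. *)

(** * One-variable calculus on intervals *)

Section OneVariable.
Variable R : realType.
Implicit Types (f g h : R -> R) (J A : set R).

Lemma is_derive_continuous f (x d : R) : is_derive x 1 f d -> {for x, continuous f}.
Proof. by move=> fd; apply/differentiable_continuous/derivable1_diffP. Qed.

Lemma mean_value J f f' (x y : R) : is_interval J ->
  (forall z, J z -> is_derive z 1 f (f' z)) -> J x -> J y ->
  exists c, [/\ J c, `|c - x| <= `|y - x| & f y - f x = f' c * (y - x)].
Proof.
move=> iJ df.
have main a b : a <= b -> J a -> J b ->
    exists2 c, a <= c <= b & f b - f a = f' c * (b - a).
  move=> ab Ja Jb.
  have inJ z : z \in `[a, b] -> J z by rewrite in_itv/=; exact: iJ.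
  have [| |c] := @MVT_segment _ f f' a b ab.
  - by move=> z zab; apply: df; apply: inJ; exact: subset_itv_oo_cc.
  - apply: continuous_in_subspaceT => z; rewrite inE/= => zab.
    exact: is_derive_continuous (df _ (inJ _ zab)).
  - by move=> cab e; exists c.
move=> Jx Jy; case: (leP x y) => [xy|/ltW yx].
- have [c cxy e] := main x y xy Jx Jy.
  exists c; split=> //; first exact: (iJ x y).
  by rewrite !ger0_norm; lra.
- have [c cxy e] := main y x yx Jy Jx.
  exists c; split=> //; first exact: (iJ y x).
  + by rewrite !ler0_norm; lra.
  + by rewrite -opprB e; ring.
Qed.

Lemma derive0_constant J f (x y : R) : is_interval J ->
  (forall z, J z -> is_derive z 1 f 0) -> J x -> J y -> f x = f y.
Proof.
move=> iJ df Jx Jy; have [c [_ _]] := mean_value iJ df Jx Jy.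
by rewrite mul0r => /subr0_eq.
Qed.

Lemma bounded_on_segment f (a b : R) :
  (forall z, a <= z <= b -> {for z, continuous f}) ->
  exists2 C, 0 <= C & forall z, a <= z <= b -> `|f z| <= C.
Proof.
move=> cf; case: (leP a b) => ab; last first.
  by exists 0 => // z ?; lra.
have cn : {within `[a, b], continuous (fun t => `|f t|)}.
  apply: continuous_in_subspaceT => t; rewrite inE/= in_itv/= => tab.
  by apply: continuous_comp; [exact: cf|exact: norm_continuous].
have [c _ cmax] := EVT_max ab cn.
by exists `|f c| => // t t01; exact: cmax.
Qed.

Lemma lipschitz_on_segment f f' (a b : R) :
  (forall z, a <= z <= b -> is_derive z 1 f (f' z)) ->
  (forall z, a <= z <= b -> {for z, continuous f'}) ->
  exists2 C, 0 <= C & forall x y, a <= x <= b -> a <= y <= b ->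
    `|f y - f x| <= C * `|y - x|.
Proof.
move=> df cf'; have [C C0 hC] := bounded_on_segment cf'.
exists C => // x y xab yab.
have [c [cab _ ->]] := mean_value (@interval_is_interval _ `[a, b]%R) df xab yab.
by rewrite normrM ler_wpM2r// hC.
Qed.

Lemma taylor1_on_segment f f' f'' (a b : R) :
  (forall z, a <= z <= b -> is_derive z 1 f (f' z)) ->
  (forall z, a <= z <= b -> is_derive z 1 f' (f'' z)) ->
  (forall z, a <= z <= b -> {for z, continuous f''}) ->
  exists2 C, 0 <= C & forall x y, a <= x <= b -> a <= y <= b ->
    `|f y - f x - f' x * (y - x)| <= C * (y - x) ^+ 2.
Proof.
move=> df df' cf''; have [C C0 hC] := lipschitz_on_segment df' cf''.
exists C => // x y xab yab.
(* The error is [(f' c - f' x) * (y - x)] with [c] between [x] and [y]. *)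
have [c [cab cx ->]] := mean_value (@interval_is_interval _ `[a, b]%R) df xab yab.
rewrite -mulrBl normrM -real_normK ?num_real// expr2 mulrA ler_wpM2r//.
by apply: le_trans (hC _ _ xab cab) _; rewrite ler_wpM2l.
Qed.

(** Differentiability from an explicit quadratic error: this is what allows
    differentiation under [wint], since [normr_wint_le] carries a uniform bound
    on the Taylor remainder of the integrand over to the integral. *)
Lemma is_derive_quadratic f (x d C : R) :
  (\forall z \near x, `|f z - f x - d * (z - x)| <= C * (z - x) ^+ 2) ->
  is_derive x 1 f d.
Proof.
move=> fC.
suff fd : h^-1 *: ((f \o shift x) (h *: (1 : R)) - f x) @[h --> 0^'] --> d.
  by apply: DeriveDef; [apply/cvg_ex; exists d|exact: cvg_lim].
have fC0 : \forall h \near (0 : R), `|f (h + x) - f x - d * h| <= C * h ^+ 2.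
  have /nbhs_ballP[e /= e0 fe] := fC.
  near=> h.
  have : ball x e (h + x).
    rewrite /ball /= opprD addrCA subrr addr0 normrN.
    by near: h; exists e => // y; rewrite /ball/= sub0r normrN.
  by move=> /fe /=; rewrite addrK.
apply/cvgrPdist_le => e e0.
near=> h.
have h0 : h != 0 by near: h; exact: nbhs_dnbhs_neq.
have hC : `|f (h + x) - f x - d * h| <= C * h ^+ 2 by near: h; exact: nbhs_dnbhs.
have he : (`|C| + 1) * `|h| <= e.
  rewrite mulrC -ler_pdivlMr; last by rewrite ltr_wpDl.
  near: h; apply: dnbhs0_le; apply: divr_gt0 => //; exact: ltr_wpDl.
rewrite /= [h%:A]mulr1 distrC -mulr_algl.
rewrite (_ : _ - d = h^-1 * (f (h + x) - f x - d * h)); last first.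
  by rewrite mulr_algl /GRing.scale/=; field.
rewrite normrM normfV ler_pdivrMl ?normr_gt0//.
apply: le_trans hC _.
rewrite mulrC -real_normK ?num_real// expr2 -mulrA ler_wpM2l//.
apply: le_trans he; rewrite mulrC ler_wpM2r//.
by rewrite (le_trans (ler_norm _))// lerDl.
Unshelve. all: by end_near. Qed.

End OneVariable.

(** * Reflection invariance of the completed Lebesgue measure *)

Section Reflection.
Variable R : realType.
Notation mu := (@completed_lebesgue_measure R).
Notation T := (caratheodory_type ((@wlength R idfun)^*)%mu).

Lemma completed_lebesgue_itv (i : interval R) :
  mu [set` i] = (if i.1 < i.2 then (i.2 : \bar R) - i.1 else 0)%E.
Proof. exact: lebesgue_measure_itv. Qed.

Lemma completed_measurable_itv (i : interval R) :
  measurable ([set` i] : set T).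
Proof. by apply: sub_caratheodory; exact: measurable_itv. Qed.

Lemma completed_lebesgue_set1 (a : R) : mu [set a] = 0%E.
Proof. by rewrite -set_itv1 completed_lebesgue_itv /= ltxx. Qed.

(** The completed measure of any set, measurable or not, is the outer measure
    generated by interval lengths.  Reflecting a cover of [A] by half-open
    intervals gives a cover of the reflected set of the same total length, which
    is one inequality; the other one follows since the reflection is an
    involution. *)
Lemma completed_lebesgue_onem (A : set R) :
  mu ((fun t : R => 1 - t)%R @^-1` A) = mu A.
Proof.
suff le_onem (B : set R) : (mu ((fun t : R => 1 - t)%R @^-1` B) <= mu B)%E.
  apply/eqP; rewrite eq_le le_onem /=.
  rewrite [X in (mu X <= _)%E](_ : _ = (fun t : R => 1 - t)%R @^-1`
    ((fun t : R => 1 - t)%R @^-1` A)) ?le_onem//.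
  by apply/seteqP; split => t /=; rewrite subKr.
apply: le_ereal_inf_tmp => _ [C [mC BC] <-].
apply: (@le_trans _ _ (mu (\bigcup_k ((fun t : R => 1 - t)%R @^-1` C k)))).
  by apply: le_mu_ext => t /BC [k _ Ck]; exists k.
apply: (le_trans (outer_measure_sigma_subadditive ((@wlength R idfun)^*)%mu _)).
apply: lee_nneseries => // k _.
have [[a b] _ <-] := mC k.
rewrite -measurable_mu_extE//; last by exists (a, b).
(* The reflected interval is closed on the left and open on the right, so it is
   not one of the generating intervals: its measure is computed instead. *)
rewrite le_eqVlt; apply/orP; left; apply/eqP.
rewrite [X in _ X = _](_ : _ = `[1 - b, 1 - a[%classic).
  rewrite -[LHS]/(mu _) -[RHS]/(mu _) !completed_lebesgue_itv /= !lte_fin.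
  rewrite ltrD2l ltrN2; case: ifP => // _.
  by rewrite -!EFinB; congr EFin; ring.
apply/seteqP; split => t /=; rewrite !in_itv/= => /andP[h1 h2]; apply/andP; split; lra.
Qed.

(** Caratheodory measurability speaks of the outer measure alone, so it is
    transported by any involution that preserves the outer measure. *)
Lemma measurable_onem : measurable_fun setT (fun t : T => (1 - t : R) : T).
Proof.
move=> _ A mA; rewrite setTI.
pose phi (t : R) : R := 1 - t.
have e Y : mu (phi @^-1` Y) = mu Y by exact: completed_lebesgue_onem.
have phiK Y : phi @^-1` (phi @^-1` Y) = Y.
  by apply/seteqP; split => t; rewrite /phi /= subKr.
suff : caratheodory_measurable ((@wlength R idfun)^*)%mu (phi @^-1` A) by [].
move=> X.
have H : mu (phi @^-1` X) =
    (mu (phi @^-1` X `&` A) + mu (phi @^-1` X `&` ~` A))%E := mA _.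
by rewrite -[LHS]e H -[mu (_ `&` A)]e -[mu (_ `&` ~` A)]e !preimage_setI phiK.
Qed.

End Reflection.

(** * Integrals under measure-preserving maps and null integrands *)

Section MeasureTheory.
Context d (T : measurableType d) (R : realType).
Variable mu : {measure set T -> \bar R}.

Lemma integral_measure_preserving (phi : T -> T) (f : T -> \bar R) :
    measurable_fun setT phi ->
    (forall A, measurable A -> mu (phi @^-1` A) = mu A) ->
    measurable_fun setT f ->
  (\int[mu]_t f t = \int[mu]_t f (phi t))%E.
Proof.
move=> mphi phimu mf.
have ge0 (k : T -> \bar R) : measurable_fun setT k -> (forall t, (0 <= k t)%E) ->
    (\int[mu]_t k t = \int[mu]_t k (phi t))%E.
  move=> mk k0.
  rewrite -[RHS](ge0_integral_pushforward mphi mu measurableT) //.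
  by apply: eq_measure_integral => A mA _; rewrite -phimu.
rewrite integralE [RHS]integralE.
have -> : ((fun t => f (phi t))^\+ = f^\+ \o phi)%E by rewrite -funepos_comp.
have -> : ((fun t => f (phi t))^\- = f^\- \o phi)%E by rewrite -funeneg_comp.
congr (_ - _)%E.
- by rewrite (ge0 (f^\+)%E)//; exact: measurable_funepos.
- by rewrite (ge0 (f^\-)%E)//; exact: measurable_funeneg.
Qed.

Variable D : set T.
Hypothesis mD : measurable D.

Lemma Rintegral_measure_preserving (phi : T -> T) (f k : T -> R) :
    measurable_fun setT phi ->
    (forall A, measurable A -> mu (phi @^-1` A) = mu A) ->
    (forall t, D (phi t) <-> D t) ->
    mu.-integrable D (EFin \o f) -> mu.-integrable D (EFin \o k) ->
    {ae mu, forall t, D t -> f (phi t) = k t} ->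
  \int[mu]_(t in D) f t = \int[mu]_(t in D) k t.
Proof.
move=> mphi phimu Dphi /measurable_int mf /measurable_int mk fk.
have De t : (phi t \in D) = (t \in D).
  by apply/idP/idP; rewrite !inE => /Dphi.
have mfT : measurable_fun setT ((EFin \o f) \_ D).
  exact/(measurable_restrictT _ mD).1.
rewrite /Rintegral; congr fine.
rewrite [LHS]integral_mkcond (integral_measure_preserving mphi phimu mfT).
rewrite [RHS]integral_mkcond; apply: ae_eq_integral => //.
- exact: (measurableT_comp mfT mphi).
- exact/(measurable_restrictT _ mD).1.
- apply: filterS fk => t fk _; rewrite !patchE De /=.
  by case: ifPn => //; rewrite inE => /fk ->.
Qed.

Lemma ae_Rintegral_ge0 (f : T -> R) : mu.-integrable D (EFin \o f) ->
  {ae mu, forall t, D t -> 0 <= f t} -> 0 <= \int[mu]_(t in D) f t.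
Proof.
move=> /measurable_int mf f0; rewrite /Rintegral fine_ge0//.
rewrite (@ae_eq_integral _ _ _ _ D (fun t => `|(f t)%:E|)%E) //.
- by apply: integral_ge0 => t _; exact: abse_ge0.
- exact: measurableT_comp.
- by apply: filterS f0 => t f0 Dt; rewrite /= ger0_norm// f0.
Qed.

(** A nonnegative function with integral zero is zero almost everywhere, so only
    the zero set of [f] matters for the conclusion on [k]. *)
Lemma Rintegral_ae_null (f k : T -> R) :
    mu.-integrable D (EFin \o f) -> mu.-integrable D (EFin \o k) ->
    {ae mu, forall t, D t -> 0 <= f t} -> \int[mu]_(t in D) f t = 0 ->
    {ae mu, forall t, D t -> f t = 0 -> k t = 0} ->
  \int[mu]_(t in D) k t = 0.
Proof.
move=> fi /measurable_int mk f0 intf fk.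
have mf := measurable_int _ fi.
have f_eq0 : ae_eq mu D (EFin \o f) (cst 0%E).
  apply/ae_eq_integral_abs => //.
  transitivity (\int[mu]_(t in D) (f t)%:E)%E.
    apply: ae_eq_integral => //; first exact: measurableT_comp.
    by apply: filterS f0 => t f0 Dt; rewrite /= ger0_norm// f0.
  have /fineK <- : (\int[mu]_(t in D) (f t)%:E)%E \is a fin_num.
    exact: integrable_fin_num.
  by congr EFin.
rewrite /Rintegral (@ae_eq_integral _ _ _ _ D (cst 0%E) _ mD mk)//.
- by rewrite integral0.
- apply: filterS2 f_eq0 fk => t /= f_eq0 fk Dt.
  by rewrite (fk Dt)//; exact: EFin_inj (f_eq0 Dt).
Qed.

End MeasureTheory.

(** * The weighted integral as a positive functional *)

Section WeightedIntegral.
Variable R : realType.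
Notation mu := (@completed_lebesgue_measure R).
Notation T := (caratheodory_type ((@wlength R idfun)^*)%mu).

(** Two-sided continuity at every point, endpoints included: it holds for the
    integrands below, which extend past the endpoints because their generators
    live on open intervals, and it spares the subspace topology. *)
Definition cont01 (h : R -> R) :=
  forall t, 0 <= t <= 1 -> {for t, continuous h}.

Definition wint (g h : R -> R) : R := \int[mu]_(t in `[0, 1]) (h t * g t).

Lemma cont01_within h : cont01 h -> {within `[0, 1], continuous h}.
Proof.
move=> ch; apply: continuous_in_subspaceT => t; rewrite inE/= in_itv/=.
exact: ch.
Qed.

Lemma cont01_cst c : cont01 (fun=> c).
Proof. by move=> t _; exact: cvg_cst. Qed.

Lemma cont01M h k : cont01 h -> cont01 k -> cont01 (fun t => h t * k t).
Proof. by move=> ch ck t t01; apply: continuousM; [exact: ch|exact: ck]. Qed.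

Lemma cont01B h k : cont01 h -> cont01 k -> cont01 (fun t => h t - k t).
Proof. by move=> ch ck t t01; apply: continuousB; [exact: ch|exact: ck]. Qed.

Lemma cont01_onem h : cont01 h -> cont01 (fun t => h (1 - t)).
Proof.
move=> ch t t01; apply: continuous_comp.
  by apply: continuousB; [exact: cvg_cst|exact: cvg_id].
by apply: ch; lra.
Qed.

Lemma cont01_measurable h : cont01 h -> measurable_fun (`[0, 1] : set T) h.
Proof.
move=> ch _ B mB; apply: sub_caratheodory.
have := @subspace_continuous_measurable_fun R `[0, 1]%classic h
  (measurable_itv _) (cont01_within ch).
exact.
Qed.

Let m01 : measurable (`[0, 1]%classic : set T).
Proof. exact: completed_measurable_itv. Qed.

Variable g : R -> R.
Hypothesis hg : sym_distr g.

Lemma wint_integrable h : cont01 h ->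
  mu.-integrable `[0, 1] (EFin \o (fun t => h t * g t)).
Proof.
move=> ch; have [_ ig _ _] := hg.
rewrite (_ : _ \o _ = (EFin \o h) \* (EFin \o g))%E; last first.
  by apply/funext => t /=; rewrite EFinM.
apply: (integrableMr m01 _ _ ig); first exact: cont01_measurable.
have [C C0 hC] := bounded_on_segment ch.
exists C; split; first exact: num_real.
move=> x Cx t /=; rewrite in_itv/= => /hC; move/le_trans; apply; exact: ltW.
Qed.

Lemma eq_wint h k : (forall t, 0 <= t <= 1 -> h t = k t) -> wint g h = wint g k.
Proof.
by move=> hk; apply: eq_Rintegral => t; rewrite inE/= in_itv/= => /hk ->.
Qed.

Lemma wintZ c h : cont01 h -> wint g (fun t => c * h t) = c * wint g h.
Proof.
move=> ch; rewrite /wint -(RintegralZl _ m01 (wint_integrable ch)).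
by apply: eq_Rintegral => t _; rewrite mulrA.
Qed.

Lemma wintB h k : cont01 h -> cont01 k ->
  wint g (fun t => h t - k t) = wint g h - wint g k.
Proof.
move=> ch ck.
rewrite /wint -(RintegralB m01 (wint_integrable ch) (wint_integrable ck)).
by apply: eq_Rintegral => t _; rewrite mulrBl.
Qed.

Lemma wint_cst c : wint g (fun=> c) = c.
Proof.
have [_ _ g1 _] := hg.
rewrite (_ : (fun=> c) = (fun t : R => c * 1)); last by rewrite mulr1.
rewrite wintZ; last exact: cont01_cst.
rewrite [X in c * X](_ : _ = 1) ?mulr1// -[RHS]g1.
by apply: eq_Rintegral => t _; rewrite mul1r.
Qed.

Let ae_mu_filter : Filter (nbhs (almost_everywhere mu)).
Proof. exact: ae_filter_ringOfSetsType. Qed.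
#[local] Existing Instance ae_mu_filter.

Lemma ae_weight_ge0 h : (forall t, 0 <= t <= 1 -> 0 <= h t) ->
  {ae mu, forall t, `[0, 1]%classic t -> 0 <= h t * g t}.
Proof.
have [g0 _ _ _] := hg => h0; apply: filterS g0 => t g0 t01.
by rewrite mulr_ge0 ?g0// h0//; move: t01; rewrite /= in_itv.
Qed.

Lemma wint_ge0 h : cont01 h -> (forall t, 0 <= t <= 1 -> 0 <= h t) ->
  0 <= wint g h.
Proof.
move=> ch h0.
exact: (ae_Rintegral_ge0 m01 (wint_integrable ch) (ae_weight_ge0 h0)).
Qed.

Lemma le_wint h k : cont01 h -> cont01 k ->
  (forall t, 0 <= t <= 1 -> h t <= k t) -> wint g h <= wint g k.
Proof.
move=> ch ck hk; rewrite -subr_ge0 -wintB//; apply: wint_ge0.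
- exact: cont01B.
- by move=> t t01; rewrite subr_ge0 hk.
Qed.

Lemma normr_wint_le h C : cont01 h -> (forall t, 0 <= t <= 1 -> `|h t| <= C) ->
  `|wint g h| <= C.
Proof.
move=> ch hC.
have hC' t : 0 <= t <= 1 -> - C <= h t <= C by move=> /hC; rewrite ler_norml.
rewrite ler_norml; apply/andP; split.
- rewrite -[leLHS]wint_cst; apply: le_wint ch _; first exact: cont01_cst.
  by move=> t /hC' /andP[].
- rewrite -[leRHS]wint_cst; apply: (le_wint ch); first exact: cont01_cst.
  by move=> t /hC' /andP[].
Qed.

Lemma wint_onem h : cont01 h -> wint g (fun t => h (1 - t)) = wint g h.
Proof.
move=> ch; have [_ _ _ gs] := hg; symmetry.
apply: (Rintegral_measure_preserving m01 (@measurable_onem R) _ _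
  (wint_integrable ch) (wint_integrable (cont01_onem ch))).
- by move=> A _; exact: completed_lebesgue_onem.
- by move=> t /=; rewrite !in_itv/=; split => ?; lra.
- by apply: filterS gs => t gt t01; rewrite gt.
Qed.

(** Weights that vanish at an endpoint, such as [t] and [1 - t], are harmless:
    the endpoints form a null set, and so they are excluded from the comparison
    of zero sets. *)
Lemma wint_null h k : cont01 h -> cont01 k ->
  (forall t, 0 <= t <= 1 -> 0 <= h t) -> wint g h = 0 ->
  (forall t, 0 < t < 1 -> h t = 0 -> k t = 0) -> wint g k = 0.
Proof.
move=> ch ck h0 Lh hk.
have n_ (a : R) : {ae mu, forall t : T, t <> a :> R}.
  exists [set a]; split; first by rewrite -set_itv1; exact: completed_measurable_itv.
  - exact: completed_lebesgue_set1.
  - by move=> t /= /notP.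
apply: (Rintegral_ae_null m01 (wint_integrable ch) (wint_integrable ck)
  (ae_weight_ge0 h0) Lh).
apply: filterS2 (n_ 0) (n_ 1) => t t0 t1 /=; rewrite in_itv/= => t01 /eqP.
rewrite mulf_eq0 => /orP[/eqP ht|/eqP ->]; last by rewrite mulr0.
rewrite hk ?mul0r//; move: t01.
by rewrite !le_eqVlt => /andP[/predU1P[/esym//|->] /predU1P[//|->]].
Qed.

End WeightedIntegral.

(** * Smooth functions on an open set *)

Section SmoothFunctions.
Variable R : realType.
Implicit Types (f g h : R -> R) (J A B : set R).

(** [n]-fold differentiability on [A], with witnesses for the derivatives.  A
    witness is constrained on [A] only, so closure under products and
    compositions is a plain induction, whereas iterated total derivatives
    agree with the expected formulas on [A] alone. *)
Fixpoint ck A n f : Prop :=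
  if n is m.+1 then
    exists f' : R -> R, (forall x : R, A x -> is_derive x 1 f (f' x)) /\ ck A m f'
  else True.

Lemma eq_on_is_derive A f g (x d : R) : open A -> {in A, f =1 g} -> A x ->
  is_derive x 1 f d -> is_derive x 1 g d.
Proof.
move=> oA fg Ax; apply: near_eq_is_derive.
by apply: filterS (open_nbhs_nbhs (conj oA Ax)) => y Ay; apply: fg; rewrite inE.
Qed.

Lemma ck_ext A n f g : open A -> {in A, f =1 g} -> ck A n f -> ck A n g.
Proof.
move=> oA; case: n => // n fg [f' [df cf']]; exists f'; split=> // x Ax.
exact: (eq_on_is_derive oA fg) (df _ Ax).
Qed.

Lemma ckW A n f : ck A n.+1 f -> ck A n f.
Proof.
by elim: n f => // n IH f [f' [df cf']]; exists f'; split=> //; exact: IH.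
Qed.

Lemma ck_derive1 A n f : open A -> ck A n.+1 f -> ck A n f^`()%classic.
Proof.
move=> oA [f' [df]]; apply: ck_ext => // y; rewrite inE => /df dfy.
by rewrite derive1E; exact/esym/derive_val.
Qed.

Lemma smooth_onP A f : open A -> smooth_on A f <-> forall n, ck A n f.
Proof.
move=> oA; split.
  move=> sf n; elim: n f sf => // n IH f sf; exists f^`()%classic; split.
    move=> x Ax; apply: DeriveDef; last by rewrite derive1E.
    exact: (sf 0%N x Ax).
  by apply: IH => m x Ax; rewrite -derive1Sn; exact: sf.
move=> cf n; have {cf} := cf n.+1; elim: n f => [f [f' [df _]] x Ax|n IH f].
  by rewrite derive1n0; have [] := df x Ax.
by move=> cf x Ax; rewrite derive1Sn; apply: IH Ax; exact: ck_derive1.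
Qed.

Lemma smooth_on_is_derive A f : smooth_on A f ->
  forall n (x : R), A x -> is_derive x 1 f^`(n)%classic (f^`(n.+1)%classic x).
Proof.
move=> sf n x Ax; apply: DeriveDef; first exact: sf.
by rewrite derive1nS derive1E.
Qed.

Lemma ck_cst A n (c : R) : ck A n (fun=> c).
Proof.
by elim: n c => // n IH c; exists (fun=> 0); split=> // x _; exact: is_derive_cst.
Qed.

Lemma ckD A n f g : ck A n f -> ck A n g -> ck A n (fun x => f x + g x).
Proof.
elim: n f g => // n IH f g [f' [df cf]] [g' [dg cg]].
exists (fun x => f' x + g' x); split; last exact: IH.
by move=> x Ax; have := df x Ax; have := dg x Ax => ? ?; exact: is_deriveD.
Qed.

Lemma is_derive1M f g (x a b : R) : is_derive x 1 f a -> is_derive x 1 g b ->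
  is_derive x 1 (fun y => f y * g y) (a * g x + f x * b).
Proof.
move=> df dg; have := @is_deriveM _ _ f g x 1 a b df dg.
by rewrite /GRing.scale /= addrC (mulrC (g x)).
Qed.

Lemma ckM A n f g : ck A n f -> ck A n g -> ck A n (fun x => f x * g x).
Proof.
elim: n f g => // n IH f g cf cg; have cf0 := ckW cf; have cg0 := ckW cg.
move: cf cg => [f' [df cf]] [g' [dg cg]].
exists (fun x => f' x * g x + f x * g' x); split.
  by move=> x Ax; exact: is_derive1M (df x Ax) (dg x Ax).
by apply: ckD; exact: IH.
Qed.

Lemma ck_expR A n f : ck A n f -> ck A n (fun x => expR (f x)).
Proof.
elim: n => // n IH cf; have cef := IH (ckW cf).
move: cf => [f' [df cf]]; exists (fun x => expR (f x) * f' x); split.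
  move=> x Ax; apply: (@is_derive1_comp _ expR f) (df x Ax).
exact: ckM.
Qed.

(** Solutions of [f' = E (f)] with smooth [E] are smooth.  The statement is about
    [h (f x)] for all smooth [h] at once, because its derivative
    [(h' E) (f x)] has the same form, which makes the induction work. *)
Lemma ck_ode A B n f E h : open B -> (forall x, A x -> B (f x)) ->
  (forall x : R, A x -> is_derive x 1 f (E (f x))) ->
  (forall n, ck B n E) -> (forall n, ck B n h) -> ck A n (fun x => h (f x)).
Proof.
move=> oB AB df cE; elim: n h => // n IH h ch.
have [h' [dh _]] := ch 1%N.
exists (fun x => h^`()%classic (f x) * E (f x)); split.
  move=> x Ax; apply: (@is_derive1_comp _ h f) (df x Ax).
  have dhx := dh _ (AB _ Ax).
  by apply: DeriveDef; [by case: dhx|rewrite derive1E].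
apply: (IH (fun y => h^`()%classic y * E y)) => m; apply: ckM => //.
exact: ck_derive1 (ch m.+1).
Qed.

Lemma is_derive_local_inverse J f g (x d : R) : open J ->
  (forall z, J z -> {for z, continuous f}) -> (forall z, J z -> g (f z) = z) ->
  J x -> is_derive x 1 f d -> d != 0 -> is_derive (f x) 1 g d^-1.
Proof.
move=> oJ cf fK Jx; have nJ : \forall z \near x, J z by exact: open_nbhs_nbhs.
by apply: is_derive_inverse; apply: filterS nJ => z; [exact: fK|exact: cf].
Qed.

End SmoothFunctions.

(** * Differentiation of integrals over segments *)

Section SegmentIntegral.
Variables (R : realType) (g : R -> R).
Hypothesis hg : sym_distr g.
Variable I : set R.
Hypotheses (oI : open I) (iI : is_interval I).

(** The weight [w] records the factors [t] and [1 - t] produced by the chain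
    rule when differentiating in [s] and in [r]; the mean itself has [w = 1]. *)
Definition segint (h w : R -> R) (s r : R) : R :=
  wint g (fun t => h (t * s + (1 - t) * r) * w t).

Lemma convex_comb_between (a b s r t : R) : 0 <= t <= 1 ->
  a <= s <= b -> a <= r <= b -> a <= t * s + (1 - t) * r <= b.
Proof. by move=> ? ? ?; apply/andP; split; nra. Qed.

Lemma interval_convex_comb (s r t : R) : 0 <= t <= 1 -> I s -> I r ->
  I (t * s + (1 - t) * r).
Proof.
move=> t01 Is Ir; case: (leP s r) => [sr|/ltW rs].
- by apply: (iI Is Ir); apply: convex_comb_between => //; lra.
- by apply: (iI Ir Is); apply: convex_comb_between => //; lra.
Qed.

Lemma open_interval_segment (s r : R) : I s -> I r ->
  exists a b, [/\ I a, I b, a < s < b & a < r < b].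
Proof.
have pt (x : R) : I x -> exists2 e, 0 < e & forall y, `|y - x| <= e -> I y.
  move=> Ix; have /nbhs_ballP[e /= e0 xe] := open_nbhs_nbhs (conj oI Ix).
  exists (e / 2) => [|y yx]; first by rewrite divr_gt0.
  by apply: xe; rewrite /ball/= distrC; lra.
move=> /pt[e e0 se] /pt[d d0 rd].
have [Is1 Is2] : I (s - e) /\ I (s + e).
  by split; apply: se; rewrite addrAC subrr add0r ?normrN gtr0_norm.
have [Ir1 Ir2] : I (r - d) /\ I (r + d).
  by split; apply: rd; rewrite addrAC subrr add0r ?normrN gtr0_norm.
exists (Num.min (s - e) (r - d)), (Num.max (s + e) (r + d)); split.
- by case: (leP (s - e) (r - d)).
- by case: (leP (s + e) (r + d)).
- by case: (leP (s - e) (r - d)); case: (leP (s + e) (r + d)); lra.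
- by case: (leP (s - e) (r - d)); case: (leP (s + e) (r + d)); lra.
Qed.

Variables (h h' h'' w : R -> R).
Hypothesis dh : forall x : R, I x -> is_derive x 1 h (h' x).
Hypothesis dh' : forall x : R, I x -> is_derive x 1 h' (h'' x).
Hypothesis ch'' : forall x : R, I x -> {for x, continuous h''}.
Hypothesis cw : cont01 w.

Lemma cont01_segment (k v : R -> R) (s r : R) :
  (forall x : R, I x -> {for x, continuous k}) -> cont01 v -> I s -> I r ->
  cont01 (fun t => k (t * s + (1 - t) * r) * v t).
Proof.
move=> ck cv Is Ir; apply: cont01M => // t t01.
apply: continuous_comp; last exact/ck/interval_convex_comb.
apply: continuousD; apply: continuousM; try exact: cvg_cst; try exact: cvg_id.
by apply: continuousB; [exact: cvg_cst|exact: cvg_id].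
Qed.

(** Exchanging [s] and [r]: this gives the symmetry of the mean, and derivatives
    in [r] from derivatives in [s]. *)
Lemma segint_onem (k v : R -> R) (s r : R) :
  (forall x : R, I x -> {for x, continuous k}) -> cont01 v -> I s -> I r ->
  segint k v s r = segint k (fun t => v (1 - t)) r s.
Proof.
move=> ck cv Is Ir; rewrite /segint -wint_onem//; last exact: cont01_segment.
by apply: eq_wint => t _; rewrite subKr addrC.
Qed.

(** Differentiation under the integral sign, through the Taylor bound of [h] on a
    compact segment of [I] containing [r] and a neighbourhood of [s]. *)
Lemma segint_is_derive1 (s r : R) : I s -> I r ->
  is_derive s 1 (fun s => segint h w s r) (segint h' (fun t => t * w t) s r).
Proof.
move=> Is Ir; have [a [b [Ia Ib sab rab]]] := open_interval_segment Is Ir.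
have inI z : a <= z <= b -> I z by exact: iI.
have [C C0 hC] := taylor1_on_segment (fun z zab => dh (inI z zab))
  (fun z zab => dh' (inI z zab)) (fun z zab => ch'' (inI z zab)).
have [W W0 hW] := bounded_on_segment cw.
have ch x : I x -> {for x, continuous h} by move=> /dh /is_derive_continuous.
have ch' x : I x -> {for x, continuous h'} by move=> /dh' /is_derive_continuous.
have ctw : cont01 (fun t => t * w t).
  by apply: cont01M => // t _; exact: cvg_id.
apply: (@is_derive_quadratic _ _ _ _ (C * W)).
have nab : \forall z \near s, a < z < b.
  have /= := @near_in_itvoo _ a b s; rewrite in_itv/= => /(_ sab).
  by apply: filterS => z; rewrite in_itv.
near=> z.
have zab : a < z < b by near: z.
have Iz : I z by apply: inI; lra.
rewrite /segint mulrC -(wintZ hg); last exact: cont01_segment.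
rewrite -(wintB hg); [|exact: cont01_segment..].
rewrite -(wintB hg); last 2 first.
- by apply: cont01B; exact: cont01_segment.
- by apply: cont01M; [exact: cont01_cst|exact: cont01_segment].
apply: normr_wint_le => //.
  apply: cont01B; first by apply: cont01B; exact: cont01_segment.
  by apply: cont01M; [exact: cont01_cst|exact: cont01_segment].
move=> t t01; set x := t * s + _; set y := t * z + _.
have yx : y - x = t * (z - s) by rewrite /x /y; ring.
rewrite (_ : _ - _ = (h y - h x - h' x * (y - x)) * w t); last by rewrite yx; ring.
have xab : a <= x <= b by apply: convex_comb_between => //; lra.
have yab : a <= y <= b by apply: convex_comb_between => //; lra.
rewrite normrM mulrAC ler_pM//; last exact: hW.
apply: le_trans (hC _ _ xab yab) _; rewrite yx exprMn ler_wpM2l//.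
by rewrite ler_piMl ?sqr_ge0// expr_le1//; lra.
Unshelve. all: by end_near. Qed.

End SegmentIntegral.

Section SegmentIntegral2.
Variables (R : realType) (g : R -> R).
Hypothesis hg : sym_distr g.
Variable I : set R.
Hypotheses (oI : open I) (iI : is_interval I).

Variables (h h' h'' w : R -> R).
Hypothesis dh : forall x : R, I x -> is_derive x 1 h (h' x).
Hypothesis dh' : forall x : R, I x -> is_derive x 1 h' (h'' x).
Hypothesis ch'' : forall x : R, I x -> {for x, continuous h''}.
Hypothesis cw : cont01 w.

Lemma segint_is_derive2 (s r : R) : I s -> I r ->
  is_derive r 1 (segint g h w s) (segint g h' (fun t => (1 - t) * w t) s r).
Proof.
move=> Is Ir.
have ch x : I x -> {for x, continuous h} by move=> /dh /is_derive_continuous.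
have ch' x : I x -> {for x, continuous h'} by move=> /dh' /is_derive_continuous.
rewrite (segint_onem hg iI)//; last first.
  apply: cont01M => // t _.
  by apply: continuousB; [exact: cvg_cst|exact: cvg_id].
have -> : (fun t => (1 - (1 - t)) * w (1 - t)) = (fun t => t * w (1 - t)).
  by apply/funext => t; rewrite subKr.
have := segint_is_derive1 hg oI iI dh dh' ch'' (cont01_onem cw) Ir Is.
apply: eq_on_is_derive oI _ Ir => z; rewrite inE => Iz.
by rewrite -(segint_onem hg iI).
Qed.

Lemma segint_continuous (s r : R) : I s -> I r ->
  {for (s, r), continuous (fun p : R * R => segint g h w p.1 p.2)}.
Proof.
move=> Is Ir; have [a [b [Ia Ib sab rab]]] := open_interval_segment oI Is Ir.
have inI z : a <= z <= b -> I z by exact: iI.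
have ch x : I x -> {for x, continuous h} by move=> /dh /is_derive_continuous.
have ch' x : I x -> {for x, continuous h'} by move=> /dh' /is_derive_continuous.
have [C C0 hC] := lipschitz_on_segment (fun z zab => dh (inI z zab))
  (fun z zab => ch' z (inI z zab)).
have [W W0 hW] := bounded_on_segment cw.
apply/cvgrPdist_le => e e0.
have CW0 : 0 <= C * W by rewrite mulr_ge0.
pose d := e / (C * W + 1).
have d0 : 0 < d by rewrite divr_gt0// ltr_wpDl.
have nab (x : R) : a < x < b -> \forall z \near x, a < z < b.
  move=> xab; have /= := @near_in_itvoo _ a b x; rewrite in_itv/= => /(_ xab).
  by apply: filterS => z; rewrite in_itv.
have nd (x : R) : \forall z \near x, `|z - x| <= d.
  by exists d => // z /=; rewrite /ball/= distrC => /ltW.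
exists ([set z | a < z < b /\ `|z - s| <= d],
        [set z | a < z < b /\ `|z - r| <= d]).
  by split; apply: filterI; [exact: nab|exact: nd|exact: nab|exact: nd].
move=> [s' r'] /= [[sab' sd] [rab' rd]].
have Is' : I s' by apply: inI; lra.
have Ir' : I r' by apply: inI; lra.
have cs := cont01_segment iI ch cw Is Ir.
have cs' := cont01_segment iI ch cw Is' Ir'.
rewrite /segint /= -(wintB hg)//.
apply: normr_wint_le => //; first exact: cont01B.
move=> t t01; set x := t * s + _; set y := t * s' + _.
have xab : a <= x <= b by apply: convex_comb_between => //; lra.
have yab : a <= y <= b by apply: convex_comb_between => //; lra.
rewrite -mulrBl normrM.
have xy : `|x - y| <= d.
  rewrite distrC ler_norml /x /y.
  by move: sd rd; rewrite !ler_norml => ? ?; apply/andP; split; nra.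
apply: (@le_trans _ _ (C * d * W)).
  apply: ler_pM => //; last exact: hW.
  by apply: le_trans (hC _ _ yab xab) _; rewrite ler_wpM2l.
rewrite mulrAC /d mulrA ler_pdivrMr ?ltr_wpDl// mulrDr mulr1 mulrC.
by rewrite lerDl ltW.
Qed.

End SegmentIntegral2.

(** * Partial derivatives as one-variable derivatives *)

Section AxisDerivatives.
Variable R : realType.
Implicit Types F : R * R -> R.

Lemma is_derive_axis1 F (x y d : R) :
  is_derive (x, y) (axis R false) F d <-> is_derive x 1 (fun s => F (s, y)) d.
Proof.
have e (h : R) : F (h *: axis R false + (x, y)) = F (h *: (1 : R) + x, y).
  by congr (F (_, _)); rewrite /= /GRing.scale/= mulr0 add0r.
have E : (fun h => h^-1 *: ((F \o shift (x, y)) (h *: axis R false) - F (x, y))) =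
   (fun h => h^-1 *: (((fun s => F (s, y)) \o shift x) (h *: (1:R)) - F (x, y))).
  by apply/funext => h; rewrite /= e.
have ED : 'D_(axis R false) F (x, y) = 'D_1 (fun s => F (s, y)) x by rewrite /derive E.
have Ed : derivable F (x, y) (axis R false) = derivable (fun s => F (s, y)) x 1.
  by rewrite /derivable E.
split=> -[dF <-].
- by apply: DeriveDef; [rewrite -Ed|rewrite ED].
- by apply: DeriveDef; [rewrite Ed|rewrite ED].
Qed.

Lemma is_derive_axis2 F (x y d : R) :
  is_derive (x, y) (axis R true) F d <-> is_derive y 1 (fun s => F (x, s)) d.
Proof.
have e (h : R) : F (h *: axis R true + (x, y)) = F (x, h *: (1 : R) + y).
  by congr (F (_, _)); rewrite /= /GRing.scale/= mulr0 add0r.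
have E : (fun h => h^-1 *: ((F \o shift (x, y)) (h *: axis R true) - F (x, y))) =
   (fun h => h^-1 *: (((fun s => F (x, s)) \o shift y) (h *: (1:R)) - F (x, y))).
  by apply/funext => h; rewrite /= e.
have ED : 'D_(axis R true) F (x, y) = 'D_1 (fun s => F (x, s)) y by rewrite /derive E.
have Ed : derivable F (x, y) (axis R true) = derivable (fun s => F (x, s)) y 1.
  by rewrite /derivable E.
split=> -[dF <-].
- by apply: DeriveDef; [rewrite -Ed|rewrite ED].
- by apply: DeriveDef; [rewrite Ed|rewrite ED].
Qed.

End AxisDerivatives.

(** * Primitives on the positive half-line *)

Lemma posR_open (R : realType) : open (@posR R).
Proof.
rewrite (_ : @posR R = `]0, +oo[%classic); first exact: interval_open.
by apply/seteqP; split => z /=; rewrite in_itv/= andbT.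
Qed.

Lemma posR_interval (R : realType) : is_interval (@posR R).
Proof. by move=> x y /= x0 _ z /andP[xz _]; exact: lt_le_trans xz. Qed.

Section Primitive.
Variable R : realType.
Notation leb := (@lebesgue_measure R).

(** The primitive vanishing at [1]; of the two integrals below one is over an
    empty interval, so that their difference is the oriented integral from [1]
    to [x].  Near a given [x] it differs by a constant from an integral with
    fixed left end [a < x], to which the fundamental theorem applies. *)
Lemma primitive_posR (v : R -> R) : (forall x : R, 0 < x -> {for x, continuous v}) ->
  exists V : R -> R, forall x : R, 0 < x -> is_derive x 1 V (v x).
Proof.
move=> cv.
exists (fun x => \int[leb]_(t in `]1, x]) v t - \int[leb]_(t in `]x, 1]) v t) => x x0.
pose a := Num.min x 1 / 2; pose b := Num.max x 1 + 1.
have [a0 ax a1] : [/\ 0 < a, a < x & a < 1].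
  by rewrite /a; case: (leP x 1) => ?; split; lra.
have [xb b1] : x < b /\ 1 < b.
  by rewrite /b; case: (leP x 1) => ?; split; lra.
have iv : leb.-integrable `[a, b] (EFin \o v).
  apply: continuous_compact_integrable; first exact: segment_compact.
  apply: continuous_in_subspaceT => z; rewrite inE/= in_itv/= => zab.
  by apply: cv; lra.
have sub (y : R) : y <= b -> leb.-integrable `[a, y] (EFin \o v).
  move=> yb; apply: integrableS iv => //.
  by apply: subset_itvl; rewrite bnd_simp.
have [dF eF] := continuous_FTC1_closed xb iv ax (cv x x0).
have dF' : is_derive x 1 (fun y => \int[leb]_(t in `[a, y]) v t -
    \int[leb]_(t in `[a, 1]) v t) (v x).
  rewrite -[v x]subr0; apply: is_deriveB.
  by apply: DeriveDef; [exact: dF|rewrite -derive1E eF].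
have oab : open (`]a, b[%classic : set R) by exact: interval_open.
apply: (eq_on_is_derive oab _ _ dF'); last by rewrite /= in_itv/= ax.
move=> y; rewrite inE/= in_itv/= => /andP[ay yb].
case: (leP 1 y) => y1.
- rewrite (Rintegral_itvB (sub y (ltW yb)));
    [|by rewrite bnd_simp ltW|by rewrite bnd_simp].
  rewrite [X in _ - X](_ : _ = 0) ?subr0//.
  by rewrite set_itv_ge ?Rintegral_set0// bnd_simp -leNgt.
- rewrite -opprB (Rintegral_itvB (sub 1 (ltW b1)));
    [|by rewrite bnd_simp ltW|by rewrite bnd_simp ltW].
  rewrite [X in X - _](_ : _ = 0) ?sub0r//.
  by rewrite set_itv_ge ?Rintegral_set0// bnd_simp -leNgt ltW.
Qed.

End Primitive.

(** * The moments of the weight *)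

Section Moments.
Variables (R : realType) (g : R -> R).
Hypothesis hg : sym_distr g.

Lemma cont01_id : cont01 (fun t : R => t).
Proof. by move=> t _; exact: cvg_id. Qed.

Lemma wint_pos (h : R -> R) : cont01 h ->
  (forall t, 0 <= t <= 1 -> 0 <= h t) -> (forall t, 0 < t < 1 -> 0 < h t) ->
  0 < wint g h.
Proof.
move=> ch h0 hpos; rewrite lt_neqAle eq_sym wint_ge0// andbT.
apply/negP => /eqP Lh.
have : wint g (fun=> 1) = 0.
  apply: (wint_null hg ch (@cont01_cst R 1) h0 Lh) => t /hpos /[swap] ->.
  by rewrite ltxx.
by rewrite (wint_cst hg) => /eqP; rewrite oner_eq0.
Qed.

Lemma first_moment : wint g (fun t => t) = 1 / 2.
Proof.
have := wint_onem hg cont01_id; rewrite wintB//; last 2 first.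
- exact: cont01_cst.
- exact: cont01_id.
by rewrite wint_cst// => e; lra.
Qed.

Lemma second_moment_lt : wint g (fun t => t * t) < 1 / 2.
Proof.
rewrite -subr_gt0 -first_moment -wintB//; last 2 first.
- exact: cont01_id.
- by apply: cont01M; exact: cont01_id.
apply: wint_pos.
- by apply: cont01B; [|apply: cont01M]; exact: cont01_id.
- by move=> t ?; nra.
- by move=> t ?; nra.
Qed.

End Moments.

(** * Generators of a mean and the formula for the characteristic function *)

Section Generator.
Variables (R : realType) (g : R -> R).
Hypothesis hg : sym_distr g.
Variables (I : set R) (f : R -> R).
Hypotheses (iI : is_interval I) (mf : unstable.strict_monotonic I f)
  (fI : f @` I = @posR R).
Notation finv := ('pinv_(fun=> 0) I f).

Lemma generator_gt0 (s : R) : I s -> 0 < f s.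
Proof. by move=> Is; have : (f @` I) (f s) by [exists s]; rewrite fI. Qed.

Lemma generator_invK (x : R) : 0 < x -> f (finv x) = x.
Proof. by move=> x0; apply: pinvK; rewrite inE fI. Qed.

Lemma generator_inv_in (x : R) : 0 < x -> I (finv x).
Proof.
move=> x0; apply: (@surjpinv_image_sub _ _ (fun=> 0) I (@posR R) f).
  by rewrite -fI.
by exists x.
Qed.

(** The sign [e] turns a decreasing generator into an increasing one, so that both
    cases are treated at once. *)
Lemma monotonic_sign : exists2 e : R, e != 0 &
  forall s r, I s -> I r -> s < r -> e * f s < e * f r.
Proof.
case: mf => mf'; [exists 1; rewrite ?oner_eq0//|
  exists (-1); rewrite ?oppr_eq0 ?oner_eq0//].
- by move=> s r Is Ir sr; rewrite !mul1r; apply: mf'; rewrite ?inE.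
- by move=> s r Is Ir sr; rewrite !mulN1r ltrN2; apply: mf'; rewrite ?inE.
Qed.

Lemma generatorK (s : R) : I s -> finv (f s) = s.
Proof.
move=> Is; apply: pinvKV; last by rewrite inE.
move=> r r'; rewrite !inE => Ir Ir' e; have [k k0 mk] := monotonic_sign.
case: (ltgtP r r') => // rr'.
- by have := mk _ _ Ir Ir' rr'; rewrite e ltxx.
- by have := mk _ _ Ir' Ir rr'; rewrite e ltxx.
Qed.

(** The image of [f] has neither a least nor a greatest element, hence neither
    has [I]: preimages of half and of twice [f s] enclose [s]. *)
Lemma generator_open : open I.
Proof.
have [e e0 me] := monotonic_sign.
rewrite openE => s Is; have s0 := generator_gt0 Is.
have [p Ip fp] : exists2 p, I p & f p = f s / 2.
  by exists (finv (f s / 2)); [apply: generator_inv_in|apply: generator_invK];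
    rewrite divr_gt0.
have [q Iq fq] : exists2 q, I q & f q = f s * 2.
  by exists (finv (f s * 2)); [apply: generator_inv_in|apply: generator_invK];
    rewrite mulr_gt0.
have lt_of (x y : R) : I x -> I y -> e * f x < e * f y -> x < y.
  move=> Ix Iy xy; case: (ltgtP x y) => // [/(me _ _ Iy Ix)|xy'].
    by rewrite ltNge (ltW xy).
  by move: xy; rewrite xy' ltxx.
have [a [b [Ia Ib sab]]] : exists a b, [/\ I a, I b & a < s < b].
  case: (ltgtP e 0) => [en|ep|e00]; last by rewrite e00 eqxx in e0.
  - exists q, p; split => //; apply/andP; split; apply: lt_of => //.
    + by rewrite fq; nra.
    + by rewrite fp; nra.
  - exists p, q; split => //; apply/andP; split; apply: lt_of => //.
    + by rewrite fp; nra.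
    + by rewrite fq; nra.
have /= := @near_in_itvoo _ a b s; rewrite in_itv/= => /(_ sab).
rewrite /interior; apply: filterS => z; rewrite in_itv/= => zab.
by apply: (iI Ia Ib); lra.
Qed.

Hypothesis sf : smooth_on I f.

Lemma generator_is_derive n (s : R) : I s ->
  is_derive s 1 f^`(n)%classic (f^`(n.+1)%classic s).
Proof. exact: smooth_on_is_derive. Qed.

Lemma generator_continuous n (s : R) : I s -> {for s, continuous f^`(n)%classic}.
Proof. by move=> /(generator_is_derive n) /is_derive_continuous. Qed.

Lemma generator_segint_is_derive1 n (w : R -> R) (s r : R) :
  cont01 w -> I s -> I r ->
  is_derive s 1 (fun s => segint g f^`(n)%classic w s r)
    (segint g f^`(n.+1)%classic (fun t => t * w t) s r).
Proof.
move=> cw Is Ir.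
exact: (segint_is_derive1 hg generator_open iI (@generator_is_derive n)
  (@generator_is_derive n.+1) (@generator_continuous n.+2)).
Qed.

Lemma generator_segint_is_derive2 n (w : R -> R) (s r : R) :
  cont01 w -> I s -> I r ->
  is_derive r 1 (segint g f^`(n)%classic w s)
    (segint g f^`(n.+1)%classic (fun t => (1 - t) * w t) s r).
Proof.
move=> cw Is Ir.
exact: (segint_is_derive2 hg generator_open iI (@generator_is_derive n)
  (@generator_is_derive n.+1) (@generator_continuous n.+2)).
Qed.

Lemma segint_diag (h w : R -> R) (s : R) : cont01 w ->
  segint g h w s s = h s * wint g w.
Proof.
move=> cw; rewrite -(wintZ hg)//; apply: eq_wint => t _; congr (h _ * _).
by ring.
Qed.

Lemma finv_is_derive (x : R) : 0 < x -> f^`()%classic (finv x) != 0 ->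
  is_derive x 1 finv (f^`()%classic (finv x))^-1.
Proof.
move=> x0 f'0; rewrite -{1}(generator_invK x0).
apply: (is_derive_local_inverse generator_open _ generatorK (generator_inv_in x0)) => //.
- by move=> z Iz; have := @generator_continuous 0 z Iz; rewrite derive1n0.
- by have := @generator_is_derive 0 _ (generator_inv_in x0); rewrite derive1n0 derive1n1.
Qed.

Lemma generator_derive_sign : exists2 e : R, e != 0 &
  (forall s r, I s -> I r -> s < r -> e * f s < e * f r) /\
  forall s, I s -> 0 <= e * f^`()%classic s.
Proof.
have [e e0 me] := monotonic_sign; exists e => //; split=> // s Is.
have oI := generator_open.
have def z : I z -> is_derive z 1 (fun x => e * f x) (e * f^`()%classic z).
  move=> /(@generator_is_derive 0); rewrite derive1n0 derive1n1 => df.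
  have := is_derive1M (is_derive_cst e z 1) df.
  by rewrite mul0r add0r.
have <- : (fun x => e * f x)^`()%classic s = e * f^`()%classic s.
  by rewrite derive1E; exact/derive_val/def.
apply: (@incr_derive1_ge0 _ _ I).
- move=> z; rewrite inE => /interior_subset Iz; exact: (@ex_derive _ _ _ _ _ _ _ (def z Iz)).
- by move=> x y; rewrite !inE => Ix Iy; exact: me.
- by move/interior_id: oI => ->.
Qed.

Variable M : R * R -> R.
Hypothesis hM : forall x y : R, 0 < x -> 0 < y ->
  M (x, y) = segint g f (fun=> 1) (finv x) (finv y).

Lemma mean_generator (s r : R) : I s -> I r ->
  M (f s, f r) = segint g f (fun=> 1) s r.
Proof.
by move=> Is Ir; rewrite hM ?generatorK//; exact: generator_gt0.
Qed.

(** At a critical point [s] of [f], the chain rule would make [M (f s, y)]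
    independent of [y]. *)
Lemma generator_derive_neq0 (s : R) :
  (forall y : R, 0 < y -> derivable M (f s, y) (axis R false)) ->
  I s -> f^`()%classic s != 0.
Proof.
move=> dM Is; apply/negP => /eqP f's0.
have [e e0 [me e_ge0]] := generator_derive_sign.
have c1 := @cont01_cst R 1.
have ct : cont01 (fun t : R => t * 1) by apply: cont01M => //; exact: cont01_id.
have c1t : cont01 (fun t : R => (1 - t) * 1).
  by apply: cont01M => //; exact: (cont01_onem (@cont01_id R)).
have ch n : forall x : R, I x -> {for x, continuous f^`(n)%classic}.
  by move=> x; exact: generator_continuous.
have oI := generator_open.
(* Both sides of [M (f s, f r) = segint g f 1 s r] are differentiated in [s];
   on the left the chain rule produces the factor [f' s = 0]. *)
have d1 r : I r -> segint g f^`()%classic (fun t => t * 1) s r = 0.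
  move=> Ir; have := generator_segint_is_derive1 0 c1 Is Ir.
  rewrite derive1n0 derive1n1 => d1.
  have /derivableP dMr := dM (f r) (generator_gt0 Ir).
  have d1' : is_derive s 1 (fun s => segint g f (fun=> 1) s r)
     ('D_(axis R false) M (f s, f r) * f^`()%classic s).
    have df := @generator_is_derive 0 _ Is.
    rewrite derive1n0 derive1n1 in df.
    have := @is_derive1_comp _ (fun x => M (x, f r)) f s _ _
      ((is_derive_axis1 _ _ _ _).1 dMr) df.
    apply: eq_on_is_derive oI _ Is => z; rewrite inE => Iz /=.
    exact: mean_generator.
  by rewrite -(@derive_val _ _ _ _ _ _ _ d1) (@derive_val _ _ _ _ _ _ _ d1') f's0 mulr0.
(* The derivative in [r] has the same integrand up to the weight, so it is null
   by comparison of zero sets. *)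
have d2 r : I r -> is_derive r 1 (segint g f (fun=> 1) s) 0.
  move=> Ir; have := generator_segint_is_derive2 0 c1 Is Ir.
  rewrite derive1n0 derive1n1 => d2.
  suff <- : segint g f^`()%classic (fun t => (1 - t) * 1) s r = 0 by [].
  apply: (wint_null hg
    (h := fun t => e * (f^`()%classic (t * s + (1 - t) * r) * (t * 1)))).
  - apply: cont01M; first exact: cont01_cst.
    by have := cont01_segment iI (ch 1%N) ct Is Ir; rewrite derive1n1.
  - by have := cont01_segment iI (ch 1%N) c1t Is Ir; rewrite derive1n1.
  - move=> t t01; rewrite mulr1 mulrA mulr_ge0//; last by lra.
    by apply: e_ge0; exact: interval_convex_comb.
  - rewrite (wintZ hg) ?[wint _ _]d1 ?mulr0//.
    by have := cont01_segment iI (ch 1%N) ct Is Ir; rewrite derive1n1.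
  - move=> t t01 /eqP; rewrite mulr1 mulf_eq0 (negbTE e0)/= mulf_eq0.
    by move=> /orP[/eqP ->|/eqP t0]; [rewrite mul0r|lra].
(* The integral at [(s, b)] therefore equals its value [f s] at [(s, s)], although
   the integrand moves strictly away from [f s] for [0 < t < 1]. *)
have [a [b [Ia Ib sab _]]] := open_interval_segment oI Is Is.
have Gb : segint g f (fun=> 1) s b = f s.
  rewrite -(derive0_constant iI d2 Is Ib) segint_diag// (wint_cst hg).
  by rewrite mulr1.
have cb : cont01 (fun t => f (t * s + (1 - t) * b) * 1).
  by have := cont01_segment iI (ch 0%N) c1 Is Ib; rewrite derive1n0.
have : 0 < wint g (fun t => e * (f (t * s + (1 - t) * b) * 1 - f s)).
  have sb t : 0 < t < 1 -> e * f s < e * f (t * s + (1 - t) * b).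
    move=> t01; apply: me => //; last by nra.
    by apply: interval_convex_comb => //; lra.
  apply: (wint_pos hg).
  - by apply: cont01M; [|apply: cont01B => //]; exact: cont01_cst.
  - move=> t t01; rewrite mulr1 mulrBr subr_ge0.
    case: (ltgtP t 0) => [t0|t0|->]; first lra.
    + case: (ltgtP t 1) => [t1|t1|->]; [by rewrite ltW// sb// t0 t1|lra|].
      by rewrite mul1r subrr mul0r addr0.
    + by rewrite mul0r add0r subr0 mul1r ltW// me//; lra.
  - by move=> t t01; rewrite mulr1 mulrBr subr_gt0 sb.
rewrite (wintZ hg)//; last by apply: cont01B => //; exact: cont01_cst.
rewrite (wintB hg)//; last exact: cont01_cst.
by rewrite (wint_cst hg) [wint _ _]Gb subrr mulr0 ltxx.
Qed.

Hypothesis f'_neq0 : forall s : R, I s -> f^`()%classic s != 0.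

Definition charac_factor := wint g (fun t => t * t) - 1 / 2.

(** The second derivative of [segint g f 1 (finv z) (finv x)] in [z] is
    [L(t^2) f'' p'^2 + L(t) f' p''] at [z = x], with [p' = 1 / f'] and
    [p'' = - f'' / f'^3]; the first moment [L(t)] is one half. *)
Lemma charac_generator (x : R) : 0 < x ->
  charac M x = charac_factor *
    (f^`(2)%classic (finv x) / f^`()%classic (finv x) ^+ 2).
Proof.
move=> x0.
have c1 := @cont01_cst R 1.
have ct : cont01 (fun t : R => t * 1) by apply: cont01M => //; exact: cont01_id.
have oP := @posR_open R.
have dfinv (z : R) : 0 < z -> is_derive z 1 finv (f^`()%classic (finv z))^-1.
  by move=> z0; apply: finv_is_derive => //; apply: f'_neq0; exact: generator_inv_in.
have f'0 := f'_neq0 (generator_inv_in x0).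
have d1 (z : R) : 0 < z -> 'D_(axis R false) M (z, x) =
    segint g f^`()%classic (fun t => t * 1) (finv z) (finv x)
      * (f^`()%classic (finv z))^-1.
  move=> z0.
  have := generator_segint_is_derive1 0 c1 (generator_inv_in z0) (generator_inv_in x0).
  rewrite derive1n0 derive1n1 => dG.
  have dM := @is_derive1_comp _ (fun s => segint g f (fun=> 1) s (finv x))
    finv z _ _ dG (dfinv z z0).
  have dM' : is_derive (z, x) (axis R false) M
     (segint g f^`()%classic (fun t => t * 1) (finv z) (finv x)
      * (f^`()%classic (finv z))^-1).
    apply/is_derive_axis1; apply: (eq_on_is_derive oP _ z0 dM) => y.
    by rewrite inE => y0; rewrite /= hM.
  exact: (@derive_val _ _ _ _ _ _ _ dM').
have := generator_segint_is_derive1 1 ct (generator_inv_in x0) (generator_inv_in x0).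
rewrite derive1n1 => dG.
have dG' := @is_derive1_comp _
    (fun s => segint g f^`()%classic (fun t => t * 1) s (finv x))
    finv x _ _ dG (dfinv x x0).
have df' := @generator_is_derive 1 _ (generator_inv_in x0).
rewrite derive1n1 in df'.
have dV := @is_deriveV _ (f^`()%classic \o finv) x _ 1 f'0
  (@is_derive1_comp _ f^`()%classic finv x _ _ df' (dfinv x x0)).
have dM := is_derive1M dG' dV.
have eqd1 : {in @posR R,
    (fun z => segint g f^`()%classic (fun t => t * 1) (finv z) (finv x)
      * (f^`()%classic (finv z))^-1) =1
    (fun z => 'D_(axis R false) M (z, x))}.
  by move=> y; rewrite inE => y0; rewrite d1.
have dM' := (is_derive_axis1 ('D_(axis R false) M) _ _ _).2
  (eq_on_is_derive oP eqd1 x0 dM).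
rewrite /charac (@derive_val _ _ _ _ _ _ _ dM') /= !segint_diag//; last first.
  by apply: cont01M => //; exact: cont01_id.
rewrite (_ : (fun t : R => t * 1) = (fun t => t)); last by apply/funext => t; rewrite mulr1.
rewrite (first_moment hg) /charac_factor /GRing.scale /=.
rewrite (_ : (fun t : R => t * (t * 1)) = (fun t => t * t)); last first.
  by apply/funext => t; rewrite mulr1.
by field.
Qed.

End Generator.

(** * Minimality *)

Section Minimality.
Variables (R : realType) (g : R -> R).
Hypothesis hg : sym_distr g.
Notation finv I f := ('pinv_(fun=> 0) I f).

Lemma integral_mean2_segint (M : R * R -> R) : integral_mean2 g M ->
  exists I f, [/\ is_interval I, smooth_on I f, unstable.strict_monotonic I f,
    f @` I = @posR R &
    (forall x y : R, 0 < x -> 0 < y ->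
      M (x, y) = segint g f (fun=> 1) (finv I f x) (finv I f y)) /\
    forall s, I s -> f^`()%classic s != 0].
Proof.
move=> [[sM _ _] [I [f [iI sf mf fI hM]]]].
have hM' (x y : R) : 0 < x -> 0 < y ->
    M (x, y) = segint g f (fun=> 1) (finv I f x) (finv I f y).
  move=> x0 y0; rewrite hM//; apply: eq_Rintegral => t _; by rewrite mulr1.
exists I, f; split=> //; split=> // s Is.
apply: (generator_derive_neq0 hg iI mf fI sf hM') => // y y0.
have fs0 := generator_gt0 fI Is.
by have [_ /(_ false)] := sM [::] (f s, y) (conj fs0 y0).
Qed.

(** The equation [a' = q a] for the slope [a x = f' (finv x)], in which
    [q = f'' / f'^2] is the quantity read off from the characteristic
    function.  Working with [a] avoids second derivatives of the inverse. *)
Lemma finv_slope_is_derive I f (x : R) : is_interval I -> smooth_on I f ->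
    unstable.strict_monotonic I f -> f @` I = @posR R ->
    (forall s, I s -> f^`()%classic s != 0) -> 0 < x ->
  is_derive x 1 (fun x => f^`()%classic (finv I f x))
    (f^`(2)%classic (finv I f x) / f^`()%classic (finv I f x)).
Proof.
move=> iI sf mf fI f'0 x0; have Ix := generator_inv_in fI x0.
have := generator_is_derive sf 1 Ix; rewrite derive1n1 => df'.
exact: (@is_derive1_comp _ f^`()%classic (finv I f) x _ _ df'
  (finv_is_derive iI mf fI sf x0 (f'0 _ Ix))).
Qed.

Lemma integral_mean2_minimal (M1 M2 : R * R -> R) :
  integral_mean2 g M1 -> integral_mean2 g M2 ->
  (forall x : R, 0 < x -> charac M1 x = charac M2 x) ->
  forall x y : R, 0 < x -> 0 < y -> M1 (x, y) = M2 (x, y).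
Proof.
move=> /integral_mean2_segint[I1 [f1 [iI1 sf1 mf1 fI1 [hM1 f1'0]]]].
move=> /integral_mean2_segint[I2 [f2 [iI2 sf2 mf2 fI2 [hM2 f2'0]]]] Q12.
set p1 := finv I1 f1 in hM1; set p2 := finv I2 f2 in hM2.
pose a1 x := f1^`()%classic (p1 x); pose a2 x := f2^`()%classic (p2 x).
have a1_neq0 x : 0 < x -> a1 x != 0 by move=> x0; apply: f1'0; exact: generator_inv_in.
have a2_neq0 x : 0 < x -> a2 x != 0 by move=> x0; apply: f2'0; exact: generator_inv_in.
(* Nonvanishing of this factor is what makes [Q_M] determine [f'' / f'^2]. *)
have k0 : charac_factor g != 0.
  by rewrite /charac_factor subr_eq0 lt_eqF// second_moment_lt.
have q12 x : 0 < x ->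
    f1^`(2)%classic (p1 x) / a1 x ^+ 2 = f2^`(2)%classic (p2 x) / a2 x ^+ 2.
  move=> x0; apply: (mulfI k0).
  have := Q12 x x0.
  by rewrite (charac_generator hg iI1 mf1 fI1 sf1 hM1 f1'0 x0)
    (charac_generator hg iI2 mf2 fI2 sf2 hM2 f2'0 x0).
have da1 (x : R) (x0 : 0 < x) := finv_slope_is_derive iI1 sf1 mf1 fI1 f1'0 x0.
have da2 (x : R) (x0 : 0 < x) := finv_slope_is_derive iI2 sf2 mf2 fI2 f2'0 x0.
pose c := a1 1 / a2 1.
have c0 : c != 0 by rewrite mulf_neq0// ?invr_eq0 ?a1_neq0 ?a2_neq0.
have a12 x : 0 < x -> a1 x = c * a2 x.
  move=> x0; have ratio0 z : @posR R z ->
      is_derive z 1 (fun y => a1 y * (a2 y)^-1) 0.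
    move=> z0.
    have := is_derive1M (da1 z z0) (@is_deriveV _ a2 z _ 1 (a2_neq0 z z0) (da2 z z0)).
    set d := (X in is_derive _ _ _ X -> _); suff -> : d = 0 by [].
    have q : f2^`(2)%classic (p2 z) =
        f1^`(2)%classic (p1 z) / a1 z ^+ 2 * a2 z ^+ 2.
      by rewrite q12// divfK// expf_neq0// a2_neq0.
    rewrite /d -/p1 -/p2 -/(a1 z) -/(a2 z) q; set b := f1^`(2)%classic (p1 z).
    rewrite /GRing.scale /=.
    by field; rewrite a1_neq0 ?a2_neq0.
  have := derive0_constant (@posR_interval R) ratio0 x0 (ltr01 : @posR R 1).
  by rewrite -/c => <-; rewrite divfK// a2_neq0.
pose d := p2 1 - c * p1 1.
have p12 x : 0 < x -> p2 x = c * p1 x + d.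
  move=> x0; have diff0 z : @posR R z ->
      is_derive z 1 (fun y => p2 y - c * p1 y) 0.
    move=> z0.
    have dp1 := finv_is_derive iI1 mf1 fI1 sf1 z0 (a1_neq0 z z0).
    have dp2 := finv_is_derive iI2 mf2 fI2 sf2 z0 (a2_neq0 z z0).
    have := is_deriveB dp2 (is_derive1M (is_derive_cst c z 1) dp1).
    set e := (X in is_derive _ _ _ X -> _); suff -> : e = 0 by [].
    rewrite /e -/p1 -/p2 -/(a1 z) -/(a2 z) mul0r add0r a12//.
    by rewrite /cst; field; rewrite c0 a2_neq0.
  have := derive0_constant (@posR_interval R) diff0 x0 (ltr01 : @posR R 1).
  by rewrite /d => <-; rewrite addrC subrK.
move=> x y x0 y0; rewrite hM1// hM2//; apply: eq_wint => t t01; congr (_ * _).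
set z := t * p1 x + (1 - t) * p1 y.
have Iz : I1 z by apply: interval_convex_comb => //; exact: generator_inv_in.
have fz0 : 0 < f1 z := generator_gt0 fI1 Iz.
rewrite (_ : _ + _ = p2 (f1 z)); first by rewrite (generator_invK fI2).
rewrite !p12// /p1 (generatorK mf1 Iz) -/p1 /z; ring.
Qed.

End Minimality.

(** * Smoothness of the mean *)

Lemma quadrant_open (R : realType) : open (@quadrant R).
Proof.
have -> : @quadrant R = fst @^-1` (@posR R) `&` snd @^-1` (@posR R) by [].
apply: openI; apply: open_comp; try exact: posR_open.
- by move=> p _; exact: cvg_fst.
- by move=> p _; exact: cvg_snd.
Qed.

Lemma continuous_prod_comp (R : realType) (G : R * R -> R) (h1 h2 : R -> R) (x y : R) :
  {for x, continuous h1} -> {for y, continuous h2} ->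
  {for (h1 x, h2 y), continuous G} ->
  {for (x, y), continuous (fun p : R * R => G (h1 p.1, h2 p.2))}.
Proof.
move=> c1 c2 cG P GP; have [[A B] /= [nA nB] AB] := cG P GP.
exists (h1 @^-1` A, h2 @^-1` B); first by split; [exact: c1|exact: c2].
by move=> [p q] /= [pA qB]; exact: (AB (h1 p, h2 q)).
Qed.

Section SmoothnessOfTheMean.
Variables (R : realType) (g : R -> R).
Hypothesis hg : sym_distr g.
Variables (I : set R) (f : R -> R).
Hypotheses (iI : is_interval I) (mf : unstable.strict_monotonic I f)
  (fI : f @` I = @posR R) (sf : smooth_on I f).
Notation finv := ('pinv_(fun=> 0) I f).
Hypothesis sfinv : forall n, ck (@posR R) n finv.

(** A class that contains the mean and is stable under both partial derivatives: the factors [A] and [B] absorb the derivatives of the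
    inverse generator.  Closure under equality on the quadrant is built in since
    a total partial derivative is known only there. *)
Inductive segint_span : (R * R -> R) -> Prop :=
| segint_span_term (A B : R -> R) n w :
    (forall m, ck (@posR R) m A) -> (forall m, ck (@posR R) m B) -> cont01 w ->
    segint_span (fun p => A p.1 * B p.2 *
      segint g f^`(n)%classic w (finv p.1) (finv p.2))
| segint_spanD F G : segint_span F -> segint_span G ->
    segint_span (fun p => F p + G p)
| segint_span_ext F G : {in @quadrant R, F =1 G} -> segint_span F -> segint_span G.

Lemma segint_span_continuous F p : segint_span F -> quadrant p ->
  {for p, continuous F}.
Proof.
move=> sF; elim: sF p => {F} [A B n w sA sB cw|F G _ cF _ cG|F G FG _ cF] [x y] Qp.
- have [x0 y0] : 0 < x /\ 0 < y := Qp.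
  have ck_cont h (z : R) : (forall m, ck (@posR R) m h) -> 0 < z -> {for z, continuous h}.
    by move=> /(_ 1%N)[h' [dh _]] /dh /is_derive_continuous.
  apply: continuousM.
    apply: (@continuous_prod_comp _ (fun p => p.1 * p.2) A B); try exact: ck_cont.
    by apply: continuousM; [exact: cvg_fst|exact: cvg_snd].
  apply: (@continuous_prod_comp _ (fun p => segint g f^`(n)%classic w p.1 p.2)
    finv finv); try exact: ck_cont.
  exact: (segint_continuous hg (generator_open iI mf fI) iI
    (fun s => @generator_is_derive _ _ _ sf n s)
    (fun s => @generator_is_derive _ _ _ sf n.+1 s)
    cw (generator_inv_in fI x0) (generator_inv_in fI y0)).
- by apply: continuousD; [exact: cF|exact: cG].
- have e : \forall q \near (x, y), F q = G q.
    apply: filterS (open_nbhs_nbhs (conj (@quadrant_open R) Qp)) => q Qq.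
    by apply: FG; rewrite inE.
  rewrite /prop_for /continuous_at -(nbhs_singleton e).
  by apply: cvg_trans (cF _ Qp); exact: near_eq_cvg.
Qed.

Lemma segint_span_partial F i : segint_span F -> exists F', segint_span F' /\
  forall p, quadrant p -> is_derive p (axis R i) F (F' p).
Proof.
elim=> {F} [A B n w sA sB cw|F G _ [F' [sF dF]] _ [G' [sG dG]]|F G FG _ [F' [sF dF]]].
- have oP := @posR_open R.
  have dck h (z : R) : (forall m, ck (@posR R) m h) -> 0 < z ->
      is_derive z 1 h (h^`()%classic z).
    move=> /(_ 1%N)[h' [dh _]] /dh dhz; rewrite derive1E.
    by rewrite (@derive_val _ _ _ _ _ _ _ dhz).
  have sd h : (forall m, ck (@posR R) m h) -> forall m, ck (@posR R) m h^`()%classic.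
    by move=> sh m; apply: ck_derive1.
  case: i.
  + exists (fun p => A p.1 * B^`()%classic p.2 *
         segint g f^`(n)%classic w (finv p.1) (finv p.2)
      + A p.1 * (B p.2 * finv^`()%classic p.2) *
         segint g f^`(n.+1)%classic (fun t => (1 - t) * w t) (finv p.1) (finv p.2)).
    split.
      apply: segint_spanD.
        by apply: segint_span_term => //; exact: sd.
      apply: (@segint_span_term A (fun y => B y * finv^`()%classic y)) => //.
        by move=> m; apply: ckM => //; exact: sd.
      by apply: cont01M => //; exact: (cont01_onem (@cont01_id R)).
    move=> [x y] [/= x0 y0]; apply/is_derive_axis2 => /=.
    have dS := @is_derive1_comp _ (segint g f^`(n)%classic w (finv x)) finv y _ _
      (generator_segint_is_derive2 hg iI mf fI sf n cw (generator_inv_in fI x0)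
        (generator_inv_in fI y0)) (dck _ _ sfinv y0).
    have := is_derive1M (is_derive1M (is_derive_cst (A x) y 1) (dck _ _ sB y0)) dS.
    by rewrite mul0r add0r /= !mulrA [in X in _ + X]mulrAC.
  + exists (fun p => A^`()%classic p.1 * B p.2 *
         segint g f^`(n)%classic w (finv p.1) (finv p.2)
      + (A p.1 * finv^`()%classic p.1) * B p.2 *
         segint g f^`(n.+1)%classic (fun t => t * w t) (finv p.1) (finv p.2)).
    split.
      apply: segint_spanD.
        by apply: segint_span_term => //; exact: sd.
      apply: (@segint_span_term (fun y => A y * finv^`()%classic y)) => //.
        by move=> m; apply: ckM => //; exact: sd.
      by apply: cont01M => //; exact: cont01_id.
    move=> [x y] [/= x0 y0]; apply/is_derive_axis1 => /=.
    have dS := @is_derive1_comp _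
      (fun s => segint g f^`(n)%classic w s (finv y)) finv x _ _
      (generator_segint_is_derive1 hg iI mf fI sf n cw (generator_inv_in fI x0)
        (generator_inv_in fI y0)) (dck _ _ sfinv x0).
    have := is_derive1M (is_derive1M (dck _ _ sA x0) (is_derive_cst (B y) x 1)) dS.
    set d1 := (X in is_derive _ _ _ X -> _).
    set d2 := (X in _ -> is_derive _ _ _ X).
    suff -> : d1 = d2 by [].
    rewrite /d1 /d2 /cst /=; ring.
- exists (fun p => F' p + G' p); split; first exact: segint_spanD.
  by move=> p Qp; apply: is_deriveD; [exact: dF|exact: dG].
- exists F'; split=> // p Qp; apply: near_eq_is_derive (dF p Qp).
  apply: filterS (open_nbhs_nbhs (conj (@quadrant_open R) Qp)) => q Qq.
  by apply: FG; rewrite inE.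
Qed.

Lemma segint_span_smooth2 F : segint_span F -> smooth2_on (@quadrant R) F.
Proof.
move=> sF s p Qp.
have sI : segint_span (iterated_partial s F).
  elim: s => //= i s IH; have [F' [sF' dF']] := segint_span_partial i IH.
  apply: segint_span_ext sF' => q; rewrite inE => Qq.
  by have dq := dF' q Qq; exact/esym/derive_val.
split; first exact: segint_span_continuous.
move=> i; have [F' [_ dF']] := segint_span_partial i sI.
by have dp := dF' p Qp; exact: ex_derive.
Qed.

End SmoothnessOfTheMean.

(** * Completeness *)

Section Completeness.
Variables (R : realType) (g : R -> R).
Hypothesis hg : sym_distr g.
Notation finv I f := ('pinv_(fun=> 0) I f).

(** The generator with prescribed logarithmic slope [W]: its inverse is a
    primitive of [exp (- W)], and the domain [I] is the image of that inverse. *)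
Lemma generator_of_slope (W v : R -> R) :
  (forall n, ck (@posR R) n v) ->
  (forall x : R, 0 < x -> is_derive x 1 W (v x)) ->
  exists (I : set R) (f : R -> R),
    [/\ is_interval I, smooth_on I f, {in I &, {homo f : s r / s < r}},
      f @` I = @posR R & [/\ forall n, ck (@posR R) n (finv I f) &
        forall s, I s -> is_derive s 1 f (expR (W (f s)))]].
Proof.
move=> sv dW.
have oP := @posR_open R.
have sW n : ck (@posR R) n W.
  by case: n => // n; exists v; split.
have sE n : ck (@posR R) n (fun x => expR (W x)) by exact: ck_expR.
have sE' n : ck (@posR R) n (fun x => expR (- W x)).
  apply: ck_expR; apply: (@ck_ext _ _ _ (fun x => -1 * W x)) => //.
    by move=> x _; rewrite mulN1r.
  by apply: ckM => //; exact: ck_cst.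
have [phi dphi] : exists phi : R -> R,
    forall x : R, 0 < x -> is_derive x 1 phi (expR (- W x)).
  apply: primitive_posR => x x0.
  by have [h [dh _]] := sE' 1%N; exact: is_derive_continuous (dh x x0).
have cphi z : @posR R z -> {for z, continuous phi}.
  by move=> /dphi /is_derive_continuous.
have phi_lt (x y : R) : 0 < x -> 0 < y -> x < y -> phi x < phi y.
  move=> x0 y0 xy; rewrite -subr_gt0.
  have [c [_ _ ->]] := mean_value (@posR_interval R) dphi x0 y0.
  by rewrite mulr_gt0 ?expR_gt0// subr_gt0.
have phi_inj (x y : R) : 0 < x -> 0 < y -> phi x = phi y -> x = y.
  move=> x0 y0 e; case: (ltgtP x y) => // [/(phi_lt _ _ x0 y0)|/(phi_lt _ _ y0 x0)];
    by rewrite e ltxx.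
pose I := phi @` @posR R; pose f := 'pinv_(fun=> 0) (@posR R) phi.
have fK (x : R) : 0 < x -> f (phi x) = x.
  move=> x0; apply: pinvKV; last by rewrite inE.
  by move=> r r'; rewrite !inE; exact: phi_inj.
have iI : is_interval I.
  apply/connected_intervalP; apply: connected_continuous_connected.
    by apply/connected_intervalP; exact: posR_interval.
  by apply: continuous_in_subspaceT => z; rewrite inE; exact: cphi.
have f_lt : {in I &, {homo f : s r / s < r}}.
  move=> s r; rewrite !inE => -[x x0 <-] [y y0 <-]; rewrite !fK//.
  case: (ltgtP x y) => // [/(phi_lt _ _ y0 x0)|->]; last by rewrite ltxx.
  by move=> yx xy; have := lt_trans xy yx; rewrite ltxx.
have fI : f @` I = @posR R.
  apply/seteqP; split => [_ [_ [x x0 <-] <-]|x x0]; first by rewrite fK.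
  by exists (phi x); [exists x|rewrite fK].
have mf : unstable.strict_monotonic I f by left.
have oI := generator_open iI mf fI.
have df s : I s -> is_derive s 1 f (expR (W (f s))).
  move=> [x x0 <-]; rewrite fK// -[expR (W x)]invrK -expRN.
  apply: (is_derive_local_inverse oP cphi fK x0 (dphi x x0)).
  by rewrite gt_eqF// expR_gt0.
exists I, f; split=> //.
  apply/smooth_onP => // n.
  apply: (@ck_ode _ I (@posR R) n f (fun x => expR (W x)) id) => //.
    exact: generator_gt0.
  move=> [|m] //; exists (fun=> 1); split; last exact: ck_cst.
  by move=> x _; exact: is_derive_id.
split=> // -[//|n]; apply: (@ck_ext _ _ _ phi) => //.
  move=> x; rewrite inE => x0.
  have <- := generatorK mf (imageP phi x0).
  by rewrite fK.
by exists (fun x => expR (- W x)); split=> // m.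
Qed.

Lemma segint_bounds (I : set R) (f : R -> R) (s r : R) :
    is_interval I -> {in I &, {homo f : s r / s < r}} ->
    (forall x, I x -> {for x, continuous f}) -> I s -> I r ->
  Num.min (f s) (f r) <= segint g f (fun=> 1) s r <= Num.max (f s) (f r).
Proof.
move=> iI lf cf Is Ir.
have le x y : I x -> I y -> x <= y -> f x <= f y.
  move=> Ix Iy; rewrite le_eqVlt => /predU1P[->//|xy].
  by rewrite ltW// lf// inE.
have cs := cont01_segment iI cf (@cont01_cst R 1) Is Ir.
suff H t : 0 <= t <= 1 -> Num.min (f s) (f r) <=
    f (t * s + (1 - t) * r) * 1 <= Num.max (f s) (f r).
  apply/andP; split.
    rewrite -[leLHS](wint_cst hg); apply: (le_wint hg _ cs); first exact: cont01_cst.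
    by move=> t /H /andP[].
  rewrite -[leRHS](wint_cst hg); apply: (le_wint hg cs); first exact: cont01_cst.
  by move=> t /H /andP[].
move=> t01; rewrite mulr1; have It := interval_convex_comb iI t01 Is Ir.
rewrite ge_min le_max; case: (leP s r) => [sr|/ltW rs].
- have zsr : s <= t * s + (1 - t) * r <= r by apply: convex_comb_between; lra.
  by rewrite [f s <= _]le ?[_ <= f r]le ?orbT//; lra.
- have zrs : r <= t * s + (1 - t) * r <= s by apply: convex_comb_between; lra.
  by rewrite [f r <= _]le ?[_ <= f s]le ?orbT//; lra.
Qed.

Lemma integral_mean2_complete (u : R -> R) : smooth_on (@posR R) u ->
  exists M : R * R -> R,
    integral_mean2 g M /\ forall x : R, 0 < x -> charac M x = u x.
Proof.
move=> /(smooth_onP _ (@posR_open R)) su.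
set k := charac_factor g.
have k0 : k != 0 by rewrite /k /charac_factor subr_eq0 lt_eqF// second_moment_lt.
pose v x := u x * k^-1.
have sv n : ck (@posR R) n v by apply: ckM => //; exact: ck_cst.
have [W dW] : exists W : R -> R, forall x : R, 0 < x -> is_derive x 1 W (v x).
  apply: primitive_posR => x x0.
  by have [h [dh _]] := sv 1%N; exact: is_derive_continuous (dh x x0).
have [I [f [iI sf lf fI [sfinv df]]]] := generator_of_slope sv dW.
have mf : unstable.strict_monotonic I f by left.
have oI := generator_open iI mf fI.
pose M (p : R * R) := segint g f (fun=> 1) (finv I f p.1) (finv I f p.2).
have cf x : I x -> {for x, continuous f} by move=> /df /is_derive_continuous.
have f'E s : I s -> f^`()%classic s = expR (W (f s)).
  by move=> Is; rewrite derive1E (@derive_val _ _ _ _ _ _ _ (df s Is)).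
have f''E s : I s -> f^`(2)%classic s = v (f s) * expR (W (f s)) ^+ 2.
  move=> Is.
  have dEW : is_derive s 1 (fun s => expR (W (f s)))
      (expR (W (f s)) * (v (f s) * expR (W (f s)))).
    apply: (@is_derive1_comp _ expR (W \o f)).
    exact: (@is_derive1_comp _ W f _ _ _ (dW _ (generator_gt0 fI Is)) (df s Is)).
  rewrite derive1nS derive1n1 derive1E.
  have dd : is_derive s 1 f^`()%classic (expR (W (f s)) * (v (f s) * expR (W (f s)))).
    by apply: (eq_on_is_derive oI _ Is dEW) => r; rewrite inE => Ir; rewrite f'E.
  by rewrite (@derive_val _ _ _ _ _ _ _ dd); ring.
have f'0 s : I s -> f^`()%classic s != 0.
  by move=> Is; rewrite f'E// gt_eqF// expR_gt0.
exists M; split; last first.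
  move=> x x0; rewrite (charac_generator hg iI mf fI sf _ f'0 x0)//.
  have Ix := generator_inv_in fI x0.
  rewrite f'E// f''E// (generator_invK fI)// mulfK ?expf_neq0 ?gt_eqF ?expR_gt0//.
  by rewrite /v mulrCA divff// mulr1.
split; first split.
- apply: (segint_span_smooth2 hg iI mf fI sf sfinv).
  apply: segint_span_ext (@segint_span_term R g I f (fun=> 1) (fun=> 1) 0 (fun=> 1) _ _ _).
  + by move=> p _; rewrite !mul1r derive1n0.
  + by move=> m; exact: ck_cst.
  + by move=> m; exact: ck_cst.
  + exact: cont01_cst.
- move=> x y x0 y0.
  have := segint_bounds iI lf cf (generator_inv_in fI x0) (generator_inv_in fI y0).
  by rewrite !(generator_invK fI).
- move=> x y x0 y0; apply: (segint_onem hg iI cf (@cont01_cst R 1)).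
  + exact: generator_inv_in.
  + exact: generator_inv_in.
- exists I, f; split=> // finv0 x y x0 y0.
  by apply: eq_Rintegral => t _; rewrite mulr1.
Qed.

End Completeness.

Theorem corollary3p53 (R : realType) (g : R -> R) (hg : sym_distr g) :
  (forall M1 M2 : R * R -> R,
     integral_mean2 g M1 -> integral_mean2 g M2 ->
     (forall x : R, 0 < x -> charac M1 x = charac M2 x) ->
     forall x y : R, 0 < x -> 0 < y -> M1 (x, y) = M2 (x, y)) /\
  (forall u : R -> R, smooth_on (@posR R) u ->
     exists M : R * R -> R,
       integral_mean2 g M /\ forall x : R, 0 < x -> charac M x = u x).
Proof.
split; first exact: integral_mean2_minimal.
exact: integral_mean2_complete.
Qed.
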